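(* Let $k$ be a positive integer and consider the $k$-th order system of two rational difference equations $$x_n=\frac{\alpha+\sum^{k}_{i=1}\beta_{i}x_{n-i} + \sum^{k}_{i=1}\gamma_{i}y_{n-i}}{A+\sum^{k}_{j=1}B_{j}x_{n-j} + \sum^{k}_{j=1}C_{j}y_{n-j}},\qquad y_n=\frac{p+\sum^{k}_{i=1}\delta_{i}x_{n-i} + \sum^{k}_{i=1}\epsilon_{i}y_{n-i}}{q+\sum^{k}_{j=1}D_{j}x_{n-j} + \sum^{k}_{j=1}E_{j}y_{n-j}},\qquad n\in\mathbb{N},$$ with non-negative real parameters and non-negative initial conditions. Assume that there exist $M_1,M_3>0$ and $M_4>M_2>0$ such that every solution satisfies $x_n\le M_1y_n+M_2\le M_3x_n+M_4$ for all $n\in\mathbb{N}$. Suppose that $A=0$ and that at least one of the following holds: (i) $I_B\cup I_C\subseteq I_\beta\cup I_\gamma$, $\alpha>0$, and $I_B\neq\emptyset$; (ii) $I_D\cup I_E\subseteq I_\delta\cup I_\epsilon$, $p>0$, and $I_C\neq\emptyset$. Suppose moreover that there exists a positive integer $\eta$ such that for every sequence $\{c_m\}_{m=1}^\infty$ with $c_m\in I_\beta\cup I_\gamma$ for all $m\ge 1$ there exist positive integers $N_1,N_2\le\eta$ such that $\sum_{m=N_1}^{N_2}c_m\in I_B\cup I_C$. Then there exist $M>0$ and $N\in\mathbb{N}$ such that every solution (from any non-negative initial conditions) satisfies $x_n\le M$ and $y_n\le M$ for all $n>N$.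
   Context: $\mathbb{N}=\{1,2,\dots\}$. Initial conditions are $x_{1-k},\dots,x_0,y_{1-k},\dots,y_0\ge 0$; a solution is a pair of sequences generated by the system from non-negative initial conditions for which all denominators are positive for every $n\in\mathbb{N}$. For each family of coefficients, the index set is the set of indices in $\{1,\dots,k\}$ with positive coefficient: $I_\beta=\{i:\beta_i>0\}$, $I_\gamma=\{i:\gamma_i>0\}$, $I_\delta=\{i:\delta_i>0\}$, $I_\epsilon=\{i:\epsilon_i>0\}$, $I_B=\{j:B_j>0\}$, $I_C=\{j:C_j>0\}$, $I_D=\{j:D_j>0\}$, $I_E=\{j:E_j>0\}$. A sum $\sum_{m=N_1}^{N_2}$ with $N_1>N_2$ is empty and equals $0$. *)

(* Defs.v *)
From mathcomp Require Import all_boot all_order all_algebra.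
From mathcomp Require Import reals.
Set Implicit Arguments.
Unset Strict Implicit.
Unset Printing Implicit Defensive.
Import Order.TTheory GRing.Theory Num.Theory.
Local Open Scope ring_scope.

(* Coefficient families are functions [nat -> R] of which only the values at
   1, ..., k are used. *)
Definition nonneg_coefs (R : realType) (k : nat) (c : nat -> R) : Prop :=
  forall i : nat, (0 < i <= k)%N -> 0 <= c i.

Definition index_set (R : realType) (k : nat) (c : nat -> R) : pred nat :=
  [pred i | (0 < i <= k)%N & 0 < c i].

(* a + \sum_{i=1}^k b_i x_{n-i} + \sum_{i=1}^k c_i y_{n-i}: the common shape of
   the numerators and denominators. *)
Definition affine_form (R : realType) (k : nat) (a : R) (b c : nat -> R)
    (x y : int -> R) (n : int) : R :=
  a + \sum_(1 <= i < k.+1) b i * x (n - i%:Z)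
    + \sum_(1 <= i < k.+1) c i * y (n - i%:Z).

(* Sequences are indexed by [int] so that the initial conditions keep their
   indices 1-k, ..., 0; values at indices below 1-k are irrelevant. *)
Definition is_solution (R : realType) (k : nat)
    (alpha : R) (beta gamma : nat -> R) (A : R) (B C : nat -> R)
    (p : R) (delta epsilon : nat -> R) (q : R) (D E : nat -> R)
    (x y : int -> R) : Prop :=
  (forall m : int, 1 - k%:Z <= m <= 0 -> 0 <= x m /\ 0 <= y m) /\
  (forall n : nat, (0 < n)%N ->
    [/\ 0 < affine_form k A B C x y n%:Z,
        0 < affine_form k q D E x y n%:Z,
        x n%:Z = affine_form k alpha beta gamma x y n%:Z
                 / affine_form k A B C x y n%:Z
      & y n%:Z = affine_form k p delta epsilon x y n%:Z
                 / affine_form k q D E x y n%:Z]).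

(* Main.v *)
(* Either of the two cases bounds one of the sequences from below (its
   denominator is dominated by its numerator, which has a positive constant
   term), hence bounds the denominator of [x_n] from below. So
   [u_n = 1 + x_n], which is comparable to [1 + y_n], satisfies
   [u_n <= H * max u_(n-i)], the maximum being over the indices occurring in
   the numerator. Follow from [n] at each step an index realizing this maximum:
   among the first [eta] points of the chain there are two, [m] and [m - j], such
   that [j] occurs in the denominator of [x_m]. The numerator of [x_m] is at
   most a constant times the next value of [u] along the chain, hence at most a
   constant times [u_(m-j)], which cancels against the denominator: [u_m] is
   bounded, and going back up the chain so is [u_n]. *)
Require Import Defs.
From mathcomp Require Import all_boot all_order all_algebra.
From mathcomp Require Import reals.
From mathcomp Require Import zify lra.
Set Implicit Arguments.
Unset Strict Implicit.
Unset Printing Implicit Defensive.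
Import Order.TTheory GRing.Theory Num.Theory.
Local Open Scope ring_scope.

(** Adding 1 to both sequences absorbs the additive constants [M2] and [M4], so that comparability
    becomes purely multiplicative, with one constant [h]. *)
Definition comparable_window (R : realType) (k : nat) (h : R)
    (x y : int -> R) (n : int) : Prop :=
  forall i : nat, (0 < i <= k)%N ->
    [/\ 0 <= x (n - i%:Z), 0 <= y (n - i%:Z),
        1 + x (n - i%:Z) <= h * (1 + y (n - i%:Z))
      & 1 + y (n - i%:Z) <= h * (1 + x (n - i%:Z))].

(** * Elementary estimates for affine forms *)

Lemma index_set_lower_bound (R : realType) (k : nat) (c : nat -> R) :
  exists2 e : R, 0 < e & forall i, i \in index_set k c -> e <= c i.
Proof.
elim: k => [|k [e e_gt0 le_e]].
  by exists 1 => // i; rewrite !inE; case: i.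
have [c_gt0|c_le0] := ltP 0 (c k.+1).
  exists (Num.min e (c k.+1)); first by rewrite lt_min e_gt0.
  move=> i; rewrite !inE => /andP[/andP[i_gt0]].
  rewrite leq_eqVlt => /predU1P[->|lt_ik] ci_gt0; rewrite ge_min ?lexx ?orbT //.
  by rewrite le_e // !inE i_gt0 ci_gt0 -ltnS lt_ik.
exists e => // i; rewrite !inE => /andP[/andP[i_gt0]].
rewrite leq_eqVlt => /predU1P[->|lt_ik] ci_gt0.
  by rewrite leNgt ci_gt0 in c_le0.
by rewrite le_e // !inE i_gt0 ci_gt0 -ltnS lt_ik.
Qed.

Lemma term_le_sum (R : realType) (k : nat) (b z : nat -> R) (j : nat) :
  nonneg_coefs k b -> (forall i, (0 < i <= k)%N -> 0 <= z i) ->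
  (0 < j <= k)%N -> b j * z j <= \sum_(1 <= i < k.+1) b i * z i.
Proof.
move=> b_ge0 z_ge0 jk; rewrite (bigD1_seq j) ?iota_uniq ?mem_index_iota //=.
rewrite lerDl big_seq_cond sumr_ge0 // => i.
by rewrite mem_index_iota => /andP[ik _]; rewrite mulr_ge0 ?b_ge0 ?z_ge0.
Qed.

Lemma sum_terms_ge0 (R : realType) (k : nat) (b z : nat -> R) :
  nonneg_coefs k b -> (forall i, (0 < i <= k)%N -> 0 <= z i) ->
  0 <= \sum_(1 <= i < k.+1) b i * z i.
Proof.
move=> b_ge0 z_ge0; rewrite big_seq sumr_ge0 // => i.
by rewrite mem_index_iota => ik; rewrite mulr_ge0 ?b_ge0 ?z_ge0.
Qed.

Lemma sum_coefs_ge0 (R : realType) (k : nat) (b : nat -> R) :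
  nonneg_coefs k b -> 0 <= \sum_(1 <= i < k.+1) b i.
Proof.
by move=> b_ge0; rewrite big_seq sumr_ge0 // => i; rewrite mem_index_iota => /b_ge0.
Qed.

(** Zero coefficients erase their terms, so [z] has to be controlled only on the index set. This is
    how the index sets enter the upper bounds. *)
Lemma sum_terms_le (R : realType) (k : nat) (b z : nat -> R) (w : R) :
  nonneg_coefs k b -> (forall i, i \in index_set k b -> z i <= w) ->
  \sum_(1 <= i < k.+1) b i * z i <= (\sum_(1 <= i < k.+1) b i) * w.
Proof.
move=> b_ge0 z_le; rewrite mulr_suml big_seq [leRHS]big_seq.
apply: ler_sum => i; rewrite mem_index_iota => ik.
have := b_ge0 i ik; rewrite le_eqVlt => /predU1P[<-|bi_gt0].
  by rewrite !mul0r.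
by rewrite ler_pM2l // z_le // !inE bi_gt0 andbT.
Qed.

Lemma affine_form_ge0 (R : realType) (k : nat) (a : R) (b c : nat -> R)
    (x y : int -> R) (n : int) :
  0 <= a -> nonneg_coefs k b -> nonneg_coefs k c ->
  (forall i : nat, (0 < i <= k)%N -> 0 <= x (n - i%:Z) /\ 0 <= y (n - i%:Z)) ->
  0 <= affine_form k a b c x y n.
Proof.
move=> a_ge0 b_ge0 c_ge0 xy_ge0; rewrite !addr_ge0 //.
  by apply: sum_terms_ge0 => // i /xy_ge0[].
by apply: sum_terms_ge0 => // i /xy_ge0[].
Qed.

Lemma affine_form_ge (R : realType) (k : nat) (a : R) (b c : nat -> R)
    (x y : int -> R) (n : int) :
  0 <= a -> nonneg_coefs k b -> nonneg_coefs k c ->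
  (forall i : nat, (0 < i <= k)%N -> 0 <= x (n - i%:Z) /\ 0 <= y (n - i%:Z)) ->
  [/\ a <= affine_form k a b c x y n,
      forall j : nat, (0 < j <= k)%N ->
        b j * x (n - j%:Z) <= affine_form k a b c x y n
    & forall j : nat, (0 < j <= k)%N ->
        c j * y (n - j%:Z) <= affine_form k a b c x y n].
Proof.
move=> a_ge0 b_ge0 c_ge0 xy_ge0; rewrite /affine_form.
set z := fun i : nat => x (n - i%:Z); set v := fun i : nat => y (n - i%:Z).
have z_ge0 i : (0 < i <= k)%N -> 0 <= z i by move=> /xy_ge0[].
have v_ge0 i : (0 < i <= k)%N -> 0 <= v i by move=> /xy_ge0[].
have sx := sum_terms_ge0 b_ge0 z_ge0; have sy := sum_terms_ge0 c_ge0 v_ge0.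
rewrite /z in sx; rewrite /v in sy.
split=> [|j jk|j jk].
- lra.
- have := term_le_sum b_ge0 z_ge0 jk; rewrite /z; lra.
- have := term_le_sum c_ge0 v_ge0 jk; rewrite /v; lra.
Qed.

Lemma affine_form_le (R : realType) (k : nat) (a : R) (b c : nat -> R)
    (x y : int -> R) (n : int) (w : R) :
  0 <= a -> nonneg_coefs k b -> nonneg_coefs k c -> 1 <= w ->
  (forall i : nat, i \in [predU index_set k b & index_set k c] ->
     x (n - i%:Z) <= w /\ y (n - i%:Z) <= w) ->
  affine_form k a b c x y n
    <= (a + \sum_(1 <= i < k.+1) b i + \sum_(1 <= i < k.+1) c i) * w.
Proof.
move=> a_ge0 b_ge0 c_ge0 w_ge1 xy_le; rewrite !mulrDl !lerD ?ler_peMr //.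
  apply: (sum_terms_le (z := fun i : nat => x (n - i%:Z))) => // i bi.
  by have [] // := xy_le i; rewrite inE /= bi.
apply: (sum_terms_le (z := fun i : nat => y (n - i%:Z))) => // i ci.
by have [] // := xy_le i; rewrite inE /= ci orbT.
Qed.

(** * Lower bounds for affine forms and their quotients under comparability *)

Lemma affine_form_dominates_terms (R : realType) (k : nat) (h L : R)
    (b c : nat -> R) :
  1 <= h -> 0 < L -> nonneg_coefs k b -> nonneg_coefs k c ->
  exists2 d : R, 0 < d & forall (a : R) x y n, 0 <= a ->
    comparable_window k h x y n -> L <= affine_form k a b c x y n ->
    forall j, j \in [predU index_set k b & index_set k c] ->
      d * (1 + x (n - j%:Z)) <= affine_form k a b c x y n /\
      d * (1 + y (n - j%:Z)) <= affine_form k a b c x y n.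
Proof.
move=> h_ge1 L_gt0 b_ge0 c_ge0.
have [eb eb_gt0 eb_le] := index_set_lower_bound k b.
have [ec ec_gt0 ec_le] := index_set_lower_bound k c.
(* [e <= L] handles the 1 in [1 + x], and [e <= eb], [e <= ec] handle the variable part. Each costs
   one copy of the form, whence the 2 in [e / (2 * h)]; the [h] pays for passing between [x] and
   [y]. *)
pose e := Num.min L (Num.min eb ec).
have e_gt0 : 0 < e by rewrite !lt_min L_gt0 eb_gt0.
have [eL [e_eb e_ec]] : e <= L /\ e <= eb /\ e <= ec.
  by rewrite /e !ge_min !lexx !orbT.
have h_gt0 : 0 < h by lra.
have h2_gt0 : 0 < 2 * h by lra.
exists (e / (2 * h)); first by rewrite divr_gt0.
move=> a x y n a_ge0 win; set F := affine_form _ _ _ _ _ _ _ => L_le j jI.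
have xy_ge0 i : (0 < i <= k)%N -> 0 <= x (n - i%:Z) /\ 0 <= y (n - i%:Z).
  by move=> /win[].
have [_ bx_le cy_le] := affine_form_ge a_ge0 b_ge0 c_ge0 xy_ge0.
have jk : (0 < j <= k)%N by move: jI; rewrite !inE => /orP[] /andP[].
have [x_ge0 y_ge0 x_le y_le] := win j jk.
(* [s] is whichever of [1 + x], [1 + y] has a positive coefficient at index [j]; [t] is either of
   the two. *)
have scale s t : 0 <= s -> t <= h * s -> e * s <= 2 * F ->
    e / (2 * h) * t <= F.
  move=> s_ge0 ts sF; rewrite mulrAC ler_pdivrMr //.
  apply: (@le_trans _ _ (e * (h * s))); first by rewrite ler_pM2l.
  rewrite mulrCA; apply: (@le_trans _ _ (h * (2 * F))); first by rewrite ler_pM2l.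
  by lra.
have self s : 0 <= s -> s <= h * s by move=> s_ge0; rewrite ler_peMl.
move: jI; rewrite inE /= => /orP[jb|jc].
  have ex : e * (1 + x (n - j%:Z)) <= 2 * F.
    have : e * x (n - j%:Z) <= F.
      by apply: le_trans (bx_le j jk); rewrite ler_wpM2r // (le_trans e_eb) // eb_le.
    by lra.
  by split; apply: (scale (1 + x (n - j%:Z))) => //; rewrite ?self ?addr_ge0.
have ey : e * (1 + y (n - j%:Z)) <= 2 * F.
  have : e * y (n - j%:Z) <= F.
    by apply: le_trans (cy_le j jk); rewrite ler_wpM2r // (le_trans e_ec) // ec_le.
  by lra.
by split; apply: (scale (1 + y (n - j%:Z))) => //; rewrite ?self ?addr_ge0.
Qed.

(** Every variable in the denominator also occurs, up to comparability, in the numerator, and the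
    positive constant [a] covers the constant term [a']. So the denominator is at most a constant
    multiple of the numerator. *)
Lemma affine_form_quotient_ge (R : realType) (k : nat) (h : R)
    (a : R) (b c : nat -> R) (a' : R) (b' c' : nat -> R) :
  1 <= h -> 0 < a -> nonneg_coefs k b -> nonneg_coefs k c ->
  0 <= a' -> nonneg_coefs k b' -> nonneg_coefs k c' ->
  {subset [predU index_set k b' & index_set k c']
     <= [predU index_set k b & index_set k c]} ->
  exists2 r : R, 0 < r & forall x y n, comparable_window k h x y n ->
    0 < affine_form k a' b' c' x y n ->
    r <= affine_form k a b c x y n / affine_form k a' b' c' x y n.
Proof.
move=> h_ge1 a_gt0 b_ge0 c_ge0 a'_ge0 b'_ge0 c'_ge0 sub.
have [d0 d0_gt0 d0P] := affine_form_dominates_terms h_ge1 a_gt0 b_ge0 c_ge0.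
pose d := Num.min a d0.
have d_gt0 : 0 < d by rewrite lt_min a_gt0.
have [d_a d_d0] : d <= a /\ d <= d0 by rewrite /d !ge_min !lexx orbT.
pose S := a' + \sum_(1 <= i < k.+1) b' i + \sum_(1 <= i < k.+1) c' i.
have S_ge0 : 0 <= S by rewrite !addr_ge0 ?sum_coefs_ge0.
have S1_gt0 : 0 < S + 1 by rewrite ltr_wpDl.
exists (d / (S + 1)); first by rewrite divr_gt0.
move=> x y n win den_gt0; rewrite ler_pdivlMr // mulrAC ler_pdivrMr //.
set F := affine_form _ a _ _ _ _ _.
have xy_ge0 i : (0 < i <= k)%N -> 0 <= x (n - i%:Z) /\ 0 <= y (n - i%:Z).
  by move=> /win[].
have [a_le _ _] := affine_form_ge (ltW a_gt0) b_ge0 c_ge0 xy_ge0.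
have dF : d <= F by apply: le_trans a_le.
have F_gt0 : 0 < F by apply: lt_le_trans dF.
(* [F / d] is at least 1 because [d <= a <= F], and it bounds all the variables that occur because
   [d <= d0]. *)
have : affine_form k a' b' c' x y n <= S * (F / d).
  apply: affine_form_le => //; first by rewrite ler_pdivlMr ?mul1r.
  move=> i i'I; have ik : (0 < i <= k)%N.
    by move: i'I; rewrite !inE => /orP[] /andP[].
  have [x_ge0 y_ge0 _ _] := win i ik.
  have [dx dy] := d0P _ _ _ _ (ltW a_gt0) win a_le _ (sub _ i'I).
  split; rewrite ler_pdivlMr // mulrC.
    apply: le_trans dx; apply: ler_pM => //; lra.
  by apply: le_trans dy; apply: ler_pM => //; lra.
rewrite mulrA ler_pdivlMr // [_ * d]mulrC => le_SF.
by apply: (le_trans le_SF); rewrite [F * _]mulrC ler_pM2r // lerDl.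
Qed.

(** * The chain of maximizing indices *)

(** [step] stands for a denominator bounded below by a constant, [jump] for one bounded below by a
    multiple of [u (n - j)], which cancels. Both are available only past [T], and [eta] backward
    steps of length at most [k] starting beyond [T + k * eta] stay past [T]. *)
Lemma chain_bound (R : realType) (k eta : nat) (I J : pred nat) (H : R)
    (T : int) (u : int -> R) :
  (forall i, i \in I -> (i <= k)%N) -> 0%N \notin J -> 1 <= H ->
  (forall c : nat -> nat, (forall m : nat, (0 < m)%N -> c m \in I) ->
     exists N1 N2 : nat,
       [/\ (0 < N1 <= eta)%N, (0 < N2 <= eta)%N
         & (\sum_(N1 <= m < N2.+1) c m)%N \in J]) ->
  (forall n, T < n -> 1 <= u n) ->
  (forall n w, T < n -> 1 <= w ->
     (forall i : nat, i \in I -> u (n - i%:Z) <= w) -> u n <= H * w) ->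
  (forall n w (j : nat), T < n -> 1 <= w -> j \in J ->
     (forall i : nat, i \in I -> u (n - i%:Z) <= w * u (n - j%:Z)) ->
     u n <= H * w) ->
  forall n, T + (k * eta)%:Z < n -> u n <= H ^+ eta * (H * H ^+ eta).
Proof.
move=> I_le J0 H_ge1 sums u_ge1 step jump n n_gt.
have H_ge0 : 0 <= H by apply: le_trans H_ge1.
have Hp_ge1 m : 1 <= H ^+ m by rewrite exprn_ege1.
(* The maximizing index requires [I] to be inhabited; for empty [I], [step] with [w = 1] already
   bounds [u n]. *)
have [/existsP[i0 Ii0]|/existsPn I0] :=
  boolP [exists i : 'I_k.+1, (i : nat) \in I]; last first.
  have /le_trans-> // : u n <= H * 1.
    apply: step => // [|i Ii]; first by move: n_gt; lia.
    have := I_le i Ii; rewrite -ltnS => ik.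
    by have := I0 (Ordinal ik); rewrite Ii.
  rewrite mulr1 mulrCA ler_peMr // -[1]mulr1.
  by apply: ler_pM.
pose g z : nat := [arg max_(i > i0 | (i : nat) \in I) u (z - (i : nat)%:Z)]%O.
have gI z : g z \in I by rewrite /g; case: arg_maxP.
have g_max z i : i \in I -> u (z - i%:Z) <= u (z - (g z)%:Z).
  move=> Ii; rewrite /g; case: arg_maxP => // j _ jmax.
  have := I_le i Ii; rewrite -ltnS => ik.
  exact: (jmax (Ordinal ik)).
pose t m := iter m (fun z => z - (g z)%:Z) n.
have tS m : t m.+1 = t m - (g (t m))%:Z by [].
have t_ge m : n - (k * m)%:Z <= t m.
  elim: m => [|m IH]; first by rewrite muln0 subr0.
  have := I_le _ (gI (t m)); rewrite tS; move: IH; lia.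
have t_gt m : (m <= eta)%N -> T < t m.
  by move=> m_le; have := t_ge m; have := leq_mul2l k m eta; rewrite m_le orbT; lia.
have u_step m : (m < eta)%N -> u (t m) <= H * u (t m.+1).
  move=> m_lt; apply: step; [exact: t_gt (ltnW m_lt) | exact/u_ge1/t_gt | ].
  by move=> i; rewrite tS; exact: g_max.
have u_chain m l : (m + l <= eta)%N -> u (t m) <= H ^+ l * u (t (m + l)%N).
  elim: l m => [|l IH] m ml; first by rewrite addn0 mul1r.
  have /le_trans-> // : u (t m) <= H * u (t m.+1) by apply: u_step; lia.
  by rewrite exprS -mulrA ler_wpM2l // -addSnnS IH //; lia.
have Hp_le l : (l <= eta)%N -> H ^+ l <= H ^+ eta.
  by move=> ?; rewrite ler_weXn2l.
(* The shift makes [c m] the length of the step from [t m.-1] to [t m]; the sum from [N1] to [N2]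
   then telescopes to [t N1.-1 - t N2]. *)
have [] := sums (fun m => g (t m.-1)) => [m _|N1 [N2 []]]; first exact: gI.
have [lt21|le12] := ltnP N2 N1; first by rewrite big_geq // (negPf J0).
(* From here [N1] denotes its predecessor, so the jump starts at [t N1]. *)
case: N1 le12 => [|N1] // le12 N1_le N2_le.
set j := (\sum_(_ <= m < _) _)%N => jJ.
have tj : t N2 = t N1 - j%:Z.
  have {jJ} : (N1 <= N2)%N by lia.
  rewrite /j; elim: N2 {le12 N2_le j} => [|N2 IH].
    by rewrite leqn0 => /eqP->; rewrite big_geq // subr0.
  rewrite leq_eqVlt => /predU1P[->|]; first by rewrite big_geq // subr0.
  by rewrite ltnS => le; rewrite tS big_nat_recr // IH //= PoszD opprD addrA.
(* [jump] with [w = H ^+ eta]: the largest [u] seen from [t N1] is at [t N1.+1], and following the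
   chain from there to [t N2 = t N1 - j] costs at most [H ^+ eta]. *)
have uN1 : u (t N1) <= H * H ^+ eta.
  apply: (jump _ _ j) => //; first by apply: t_gt; lia.
  move=> i /(g_max (t N1)) /le_trans->//; rewrite -tS -tj.
  have := u_chain N1.+1 (N2 - N1.+1)%N; rewrite subnKC // => /(_ _) /le_trans->//.
    by lia.
  rewrite ler_wpM2r //; last by apply: Hp_le; lia.
  by rewrite (le_trans ler01) // u_ge1 // t_gt //; lia.
have := u_chain 0%N N1; rewrite add0n => /(_ _) /le_trans->//; first by lia.
apply: ler_pM => //; [exact: exprn_ge0| |by apply: Hp_le; lia].
by rewrite (le_trans ler01) // u_ge1 // t_gt //; lia.
Qed.

(** * Solutions of the system and the uniform bound *)

Lemma solution_ge0 (R : realType) (k : nat)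
    (alpha : R) (beta gamma : nat -> R) (A : R) (B C : nat -> R)
    (p : R) (delta epsilon : nat -> R) (q : R) (D E : nat -> R)
    (x y : int -> R) :
  0 <= alpha -> 0 <= p -> nonneg_coefs k beta -> nonneg_coefs k gamma ->
  nonneg_coefs k delta -> nonneg_coefs k epsilon ->
  is_solution k alpha beta gamma A B C p delta epsilon q D E x y ->
  forall m : int, 1 - k%:Z <= m -> 0 <= x m /\ 0 <= y m.
Proof.
move=> alpha_ge0 p_ge0 beta_ge0 gamma_ge0 delta_ge0 epsilon_ge0 [init rec].
(* Bounding [m] above by [n] makes the induction hypothesis cover the whole window of [k] preceding
   indices. *)
suff below (n : nat) m : 1 - k%:Z <= m <= n%:Z -> 0 <= x m /\ 0 <= y m.
  by move=> m m_ge; apply: (below `|m|%N); rewrite m_ge /=; lia.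
elim: n m => [|n IH] m; first exact: init.
have [m_le|m_gt] := leP m n%:Z; first by move=> /andP[m_ge _]; apply: IH; rewrite m_ge.
move=> m_in; have -> : m = n.+1%:Z by lia.
have xy_ge0 i : (0 < i <= k)%N ->
    0 <= x (n.+1%:Z - i%:Z) /\ 0 <= y (n.+1%:Z - i%:Z).
  by move=> ik; apply: IH; lia.
have [dx dy -> ->] := rec n.+1 isT.
by split; apply: divr_ge0; rewrite ?(ltW dx) ?(ltW dy) ?affine_form_ge0.
Qed.

Theorem theorem22 (R : realType) (k : nat)
  (alpha : R) (beta gamma : nat -> R) (A : R) (B C : nat -> R)
  (p : R) (delta epsilon : nat -> R) (q : R) (D E : nat -> R)
  (k_gt0 : (0 < k)%N)
  (alpha_ge0 : 0 <= alpha) (A_ge0 : 0 <= A) (p_ge0 : 0 <= p) (q_ge0 : 0 <= q)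
  (beta_ge0 : nonneg_coefs k beta) (gamma_ge0 : nonneg_coefs k gamma)
  (B_ge0 : nonneg_coefs k B) (C_ge0 : nonneg_coefs k C)
  (delta_ge0 : nonneg_coefs k delta) (epsilon_ge0 : nonneg_coefs k epsilon)
  (D_ge0 : nonneg_coefs k D) (E_ge0 : nonneg_coefs k E)
  (comparable : exists M1 M2 M3 M4 : R,
     [/\ 0 < M1, 0 < M3, 0 < M2, M2 < M4 &
       forall x y : int -> R,
         is_solution k alpha beta gamma A B C p delta epsilon q D E x y ->
         forall n : nat, (0 < n)%N ->
           x n%:Z <= M1 * y n%:Z + M2 /\
           M1 * y n%:Z + M2 <= M3 * x n%:Z + M4])
  (A_eq0 : A = 0)
  (cases :
     [/\ {subset [predU index_set k B & index_set k C]
            <= [predU index_set k beta & index_set k gamma]},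
         0 < alpha & exists j : nat, j \in index_set k B]
     \/
     [/\ {subset [predU index_set k D & index_set k E]
            <= [predU index_set k delta & index_set k epsilon]},
         0 < p & exists j : nat, j \in index_set k C])
  (sums : exists eta : nat, (0 < eta)%N /\
     forall c : nat -> nat,
       (forall m : nat, (0 < m)%N ->
          c m \in [predU index_set k beta & index_set k gamma]) ->
       exists N1 N2 : nat,
         [/\ (0 < N1 <= eta)%N, (0 < N2 <= eta)%N &
             (\sum_(N1 <= m < N2.+1) c m)%N
               \in [predU index_set k B & index_set k C]]) :
  exists (M : R) (N : nat),
    [/\ 0 < M, (0 < N)%N &
      forall x y : int -> R,
        is_solution k alpha beta gamma A B C p delta epsilon q D E x y ->
        forall n : nat, (N < n)%N -> x n%:Z <= M /\ y n%:Z <= M].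
Proof.
have [M1 [M2 [M3 [M4 [M1_gt0 M3_gt0 M2_gt0 M4_gt comp]]]]] := comparable.
have [eta [eta_gt0 sumsP]] := sums.
(* [1 + M1 + M2] serves [x <= M1 * y + M2]; the quotient serves [M1 * y <= M3 * x + M4], obtained by
   dropping [M2 > 0]. *)
pose h := 1 + M1 + M2 + (M3 + M4) / M1.
have q_gt0 : 0 < (M3 + M4) / M1 by rewrite divr_gt0 //; lra.
have h_ge1 : 1 <= h by rewrite /h; lra.
pose sol := is_solution k alpha beta gamma A B C p delta epsilon q D E.
have ge0 x y m : sol x y -> 0 < m -> 0 <= x m /\ 0 <= y m.
  move=> xy m_gt0.
  have := solution_ge0 alpha_ge0 p_ge0 beta_ge0 gamma_ge0 delta_ge0 epsilon_ge0 xy.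
  by apply; clear -m_gt0 k_gt0; lia.
have cmp x y (m : int) : sol x y -> 0 < m ->
    1 + x m <= h * (1 + y m) /\ 1 + y m <= h * (1 + x m).
  move=> xy; case: m => // m m_gt0; have [x_ge0 y_ge0] := ge0 x y m xy m_gt0.
  have [xy_le yx_le] := comp x y xy m m_gt0.
  have y_le : y m <= M3 / M1 * x m + M4 / M1.
    by rewrite mulrAC -mulrDl ler_pdivlMr //; lra.
  have r3 : 0 < M3 / M1 by rewrite divr_gt0.
  have r4 : 0 < M4 / M1 by rewrite divr_gt0 //; lra.
  have hE : h = 1 + M1 + M2 + M3 / M1 + M4 / M1 by rewrite /h mulrDl addrA.
  rewrite hE; split; nra.
(* Comparability is given only at positive indices; [k < n] keeps the window clear of the initial
   conditions. *)
have win x y n : sol x y -> k%:Z < n -> comparable_window k h x y n.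
  move=> xy n_gt i ik; have i_gt0 : 0 < n - i%:Z.
    by clear -ik n_gt; lia.
  by have [x_ge0 y_ge0] := ge0 x y _ xy i_gt0; have [xy_le yx_le] := cmp x y _ xy i_gt0.
have recE x y (n : int) : sol x y -> 0 < n ->
    [/\ 0 < affine_form k A B C x y n, 0 < affine_form k q D E x y n,
        x n = affine_form k alpha beta gamma x y n / affine_form k A B C x y n
      & y n = affine_form k p delta epsilon x y n
              / affine_form k q D E x y n].
  by case: n => // n [_ rec] /rec.
(* A single term [B j * x (n - j)] or [C j * y (n - j)] of the denominator suffices, its variable
   being bounded below as a quotient. Past [2k], the window of [n - j] still has positive indices
   only. *)
have [L L_gt0 den_ge] : exists2 L : R, 0 < L & forall x y n, sol x y ->
    (k + k)%:Z < n -> L <= affine_form k A B C x y n.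
  have den_terms x y (n : int) : sol x y -> (k + k)%:Z < n ->
      (forall j : nat, (0 < j <= k)%N ->
        B j * x (n - j%:Z) <= affine_form k A B C x y n) /\
      (forall j : nat, (0 < j <= k)%N ->
        C j * y (n - j%:Z) <= affine_form k A B C x y n).
    move=> xy n_gt.
    have n_gtk : k%:Z < n by clear -n_gt; lia.
    by have [] // := @affine_form_ge _ k A B C x y n => // i /(win x y n xy n_gtk)[].
  case: cases => -[sub gt0 [j]]; rewrite !inE => /andP[jk cj_gt0].
    have [r r_gt0 rP] := affine_form_quotient_ge h_ge1 gt0 beta_ge0 gamma_ge0
      A_ge0 B_ge0 C_ge0 sub.
    exists (B j * r) => [|x y n xy n_gt]; first exact: mulr_gt0.
    have [bx _] := den_terms x y n xy n_gt; apply: le_trans (bx j jk).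
    have [|den_gt0 _ -> _] := recE x y (n - j%:Z) xy;
      first by clear -jk n_gt; lia.
    by rewrite ler_pM2l // rP //; apply: win => //; clear -jk n_gt; lia.
  have [r r_gt0 rP] := affine_form_quotient_ge h_ge1 gt0 delta_ge0 epsilon_ge0
    q_ge0 D_ge0 E_ge0 sub.
  exists (C j * r) => [|x y n xy n_gt]; first exact: mulr_gt0.
  have [_ cy] := den_terms x y n xy n_gt; apply: le_trans (cy j jk).
  have [|_ den_gt0 _ ->] := recE x y (n - j%:Z) xy;
    first by clear -jk n_gt; lia.
  by rewrite ler_pM2l // rP //; apply: win => //; clear -jk n_gt; lia.
have [d d_gt0 dP] := affine_form_dominates_terms h_ge1 L_gt0 B_ge0 C_ge0.
pose S := alpha + \sum_(1 <= i < k.+1) beta i + \sum_(1 <= i < k.+1) gamma i.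
have S_ge0 : 0 <= S by rewrite !addr_ge0 ?sum_coefs_ge0.
pose I := [predU index_set k beta & index_set k gamma].
pose J := [predU index_set k B & index_set k C].
have I_k i : i \in I -> (0 < i <= k)%N by rewrite !inE => /orP[] /andP[].
have J_k i : i \in J -> (0 < i <= k)%N by rewrite !inE => /orP[] /andP[].
(* A bound on [1 + x] alone controls [y] too, at the cost of the factor [h]. *)
have num_le x y n w : sol x y -> k%:Z < n -> 1 <= w ->
    (forall i, i \in I -> 1 + x (n - i%:Z) <= w) ->
    affine_form k alpha beta gamma x y n <= S * h * w.
  move=> xy n_gt w_ge1 x_le; rewrite -mulrA.
  have w_le : w <= h * w by rewrite ler_peMl // (le_trans ler01).
  apply: affine_form_le => //; first exact: le_trans w_le.
  move=> i iI; have [x_ge0 y_ge0 _ y_le] := win x y n xy n_gt i (I_k i iI).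
  have xw := x_le i iI; have h_gt0 : 0 < h by lra.
  have hxw : h * (1 + x (n - i%:Z)) <= h * w by rewrite ler_pM2l.
  by split; lra.
(* The summand over [L] serves [step], the one over [d] serves [jump]. The leading 1 gives [1 <= H]
   and absorbs, since [1 <= w], the 1 in [1 + x n]. *)
pose H := 1 + S * h / L + S * h / d.
have Sh_ge0 : 0 <= S * h by rewrite mulr_ge0 // (le_trans ler01).
have ShL_ge0 : 0 <= S * h / L by rewrite divr_ge0 // ltW.
have Shd_ge0 : 0 <= S * h / d by rewrite divr_ge0 // ltW.
have H_ge1 : 1 <= H by rewrite /H; lra.
pose G := H ^+ eta * (H * H ^+ eta).
have bound x y n : sol x y -> (k + k)%:Z + (k * eta)%:Z < n -> 1 + x n <= G.
  move=> xy; apply: (@chain_bound _ k eta I J H (k + k)%:Z (fun m => 1 + x m)) => //.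
  - by move=> i /I_k /andP[].
  - by move=> {}n n_gt; rewrite lerDl; have [] := ge0 x y n xy _; first by clear -n_gt; lia.
  - move=> {}n w n_gt w_ge1 x_le; have [|den_gt0 _ -> _] := recE x y n xy; first by clear -n_gt; lia.
    have num := num_le x y n w xy _ w_ge1 x_le.
    have : affine_form k alpha beta gamma x y n / affine_form k A B C x y n
        <= S * h / L * w.
      rewrite [leRHS]mulrAC; apply: ler_pM.
      - by apply: affine_form_ge0 => // i ik; apply: ge0 => //; clear -n_gt ik; lia.
      - by rewrite invr_ge0 ltW.
      - by apply: num; clear -n_gt; lia.
      - by rewrite lef_pV2 ?posrE // den_ge.
    by rewrite /H; nra.
  move=> {}n w j n_gt w_ge1 jJ; set u := 1 + x (n - j%:Z) => x_le.
  have [|den_gt0 _ -> _] := recE x y n xy; first by clear -n_gt; lia.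
  have n_gtk : k%:Z < n by clear -n_gt; lia.
  have [x_ge0 _ _ _] := win x y n xy n_gtk j (J_k j jJ).
  have u_ge1 : 1 <= u by rewrite lerDl.
  have num := num_le x y n (w * u) xy n_gtk (mulr_ege1 w_ge1 u_ge1) x_le.
  have [du _] := dP _ _ _ _ A_ge0 (win x y n xy n_gtk) (den_ge x y n xy n_gt) j jJ.
  have : affine_form k alpha beta gamma x y n / affine_form k A B C x y n
      <= S * h / d * w.
    rewrite ler_pdivrMr //; apply: (le_trans num).
    (* Isolating [d * u], a lower bound of the denominator, is the cancellation that removes [u]. *)
    have -> : S * h * (w * u) = S * h / d * w * (d * u).
      by rewrite [S * h / d * w]mulrAC -[RHS]mulrA mulKf ?gt_eqF // mulrA.
    by rewrite ler_wpM2l // mulr_ge0 // (le_trans ler01).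
  by rewrite /H; nra.
have G_gt0 : 0 < G by rewrite !mulr_gt0 ?exprn_gt0 // (lt_le_trans ltr01).
(* [G] bounds [1 + x n]; the factor [h] carries this over to [y n]. *)
exists (h * G), (k + k + k * eta)%N; split=> //; first by nra.
  by clear -k_gt0; lia.
move=> x y xy n n_gt; have n_gt0 : 0 < n%:Z by clear -n_gt; lia.
have [x_ge0 y_ge0] := ge0 x y _ xy n_gt0.
have [_ y_le] := cmp x y _ xy n_gt0.
have x_le := bound x y n%:Z xy _; have {}x_le : 1 + x n <= G by apply: x_le; clear -n_gt; lia.
by split; nra.
Qed.
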